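(* Fix $\lambda \in (0,1)$, and let $f:\mathbb{R} \to \mathbb{R}$ be a differentiable function satisfying $$\frac{f(b) - f(a)}{b-a} = f'\left(\lambda a + (1-\lambda) b\right)$$ for all real numbers $a < b$. Then $f$ is a polynomial of degree at most $2$. Further, if $\lambda \neq \tfrac{1}{2}$, then $f$ is a polynomial of degree at most $1$.
   Context: Differentiable means differentiable at every point of $\mathbb{R}$; no continuity of $f'$ is assumed. *)

(* Defs.v *)
From HB Require Import structures.
From mathcomp Require Import all_boot all_order all_algebra.
From mathcomp Require Import all_classical all_reals all_analysis.
Set Implicit Arguments.
Unset Strict Implicit.
Unset Printing Implicit Defensive.

Local Open Scope ring_scope.

(* size p is one more than the degree of p, and 0 for the zero polynomial,
   so the zero polynomial has degree at most d for every d. *)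
Definition is_polynomial_of_degree_at_most (R : realType) (d : nat)
    (f : R -> R) : Prop :=
  exists2 p : {poly R}, (size p <= d.+1)%N & forall x : R, f x = p.[x].

(* Main.v *)
Require Import Defs.
From mathcomp Require Import all_boot all_order all_algebra.
From mathcomp Require Import all_classical all_reals all_analysis.
From mathcomp Require Import ring lra.
Import Order.TTheory GRing.Theory Num.Theory.
Import numFieldNormedType.Exports.
Local Open Scope ring_scope.

(** Write g for f' and put a = x - (1 - lambda) h, b = x + lambda h.  Then
    lambda a + (1 - lambda) b = x and b - a = h, so the hypothesis becomes
      f (x + lambda h) - f (x - (1 - lambda) h) = h g(x)   for h > 0,
    where x and h vary independently.  Hence g is itself a difference of
    translates of f (take h = 1), so it is differentiable although f' was not
    assumed continuous, and the identity can be differentiated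
    - in x: g (x + lambda h) - g (x - (1 - lambda) h) = h g'(x)
      ([derivative_increment]);
    - in h: lambda g (x + lambda h) + (1 - lambda) g (x - (1 - lambda) h) = g x
      ([derivative_average]).
    From here on everything is algebra.  Eliminating the value on the left of x
    gives g (x + lambda h) = g x + (1 - lambda) h g'(x): to the right of every
    point, g is affine.  The slopes seen from two points must agree, so g' is a
    constant c and g is affine on the whole line with slope
    c (1 - lambda) / lambda.  That slope is also c, so
    c (1 - lambda) = c lambda ([derivative_affine]); thus c = 0 unless
    lambda = 1/2.  Finally the mean value identity with an endpoint at 0
    recovers f from the affine function g without any integration. *)

Lemma is_derive_comp_affine (R : realType) (f : R -> R) (a b x : R) :
  derivable f (a + x * b) 1 ->
  is_derive x 1 (fun y : R => f (a + y * b)) (b * f^`()%classic (a + x * b)).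
Proof.
move=> df.
have Da : is_derive x 1 (fun y : R => a + y * b) b.
  have D : is_derive x 1 (cst a + (fun y : R => y * b)) (0 + (x *: 0 + b *: 1)).
    exact: is_deriveD.
  by apply: is_derive_eq D _; rewrite scaler0 !add0r /GRing.scale /= mulr1.
rewrite mulrC derive1E.
by apply: (is_derive1_comp (f := f) (g := fun y : R => a + y * b));
  first exact: derivableP.
Qed.

Lemma is_derive_unique (R : realType) (f : R -> R) (x a b : R) :
  is_derive x 1 f a -> is_derive x 1 f b -> a = b.
Proof. by move=> [_ <-] [_ <-]. Qed.

Lemma centered_increment (R : realType) (lambda : R) (f g : R -> R) :
  (forall a b : R, a < b ->
     (f b - f a) / (b - a) = g (lambda * a + (1 - lambda) * b)) ->
  forall x h : R, 0 < h ->
    f (x + lambda * h) - f (x - (1 - lambda) * h) = h * g x.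
Proof.
move=> fg x h h0.
have lt_ab : x - (1 - lambda) * h < x + lambda * h by lra.
move: (fg _ _ lt_ab).
have -> : x + lambda * h - (x - (1 - lambda) * h) = h by ring.
have -> : lambda * (x - (1 - lambda) * h) + (1 - lambda) * (x + lambda * h) = x.
  by ring.
by move=> <-; rewrite [RHS]mulrC divfK // gt_eqF.
Qed.

Section CenteredIncrement.
Variables (R : realType) (lambda : R) (f : R -> R).
Hypothesis f_differentiable : forall x : R, derivable f x 1.
Let g := (f^`()%classic : R -> R).
Hypothesis f_increment : forall x h : R, 0 < h ->
  f (x + lambda * h) - f (x - (1 - lambda) * h) = h * g x.

Let is_derive_translate (a x : R) :
  is_derive x 1 (fun y : R => f (a + y * 1)) (g (a + x * 1)).
Proof.
by apply: is_derive_eq (is_derive_comp_affine _ _ _ _ _ _) _; rewrite // mul1r.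
Qed.

(** Differentiating in x.  The case h = 1 exhibits the derivative of g as a
    difference of values of g, and then both sides of the identity for an
    arbitrary h can be differentiated. *)
Lemma derivative_increment : exists g' : R -> R, forall x h : R, 0 < h ->
  g (x + lambda * h) - g (x - (1 - lambda) * h) = h * g' x.
Proof.
have D (x h : R) : is_derive x 1
    (fun y : R => f (y + lambda * h) - f (y - (1 - lambda) * h))
    (g (x + lambda * h) - g (x - (1 - lambda) * h)).
  have := is_deriveB (is_derive_translate (lambda * h) x)
                     (is_derive_translate (- ((1 - lambda) * h)) x).
  rewrite !mulr1 ![_ + x]addrC; congr (is_derive _ _ _ _).
  by apply/funext => y /=; rewrite !fctE !mulr1 ![_ + y]addrC.
exists (fun x => g (x + lambda * 1) - g (x - (1 - lambda) * 1)) => x h h0.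
have Dg : is_derive x 1 g (g (x + lambda * 1) - g (x - (1 - lambda) * 1)).
  have := D x 1; congr (is_derive _ _ _ _).
  by apply/funext => y; rewrite f_increment// mul1r.
have Dhg : is_derive x 1 (h \*: g)
    (g (x + lambda * h) - g (x - (1 - lambda) * h)).
  have := D x h; congr (is_derive _ _ _ _).
  by apply/funext => y; rewrite f_increment.
exact: is_derive_unique Dhg (is_deriveZ h Dg).
Qed.

(** Differentiating in h.  The identity only holds for h > 0, an open
    condition, hence in a neighbourhood of the given h. *)
Lemma derivative_average (x h : R) : 0 < h ->
  lambda * g (x + lambda * h) + (1 - lambda) * g (x - (1 - lambda) * h) = g x.
Proof.
move=> h0.
have D := is_deriveB
  (is_derive_comp_affine R f x lambda h (f_differentiable _))
  (is_derive_comp_affine R f x (- (1 - lambda)) h (f_differentiable _)).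
have Dlin : is_derive h 1 (g x \*: (id : R -> R)) (g x *: 1).
  exact: is_deriveZ.
have increment_linear : \near h,
    ((fun k : R => f (x + k * lambda)) -
     (fun k : R => f (x + k * - (1 - lambda)))) h = (g x \*: (id : R -> R)) h.
  near=> k.
  rewrite !fctE mulrN ![k * _]mulrC f_increment; first exact: mulrC.
  by near: k; exact: lt_nbhsr.
have := is_derive_unique _ _ _ _ _ (near_eq_is_derive increment_linear D) Dlin.
rewrite /GRing.scale /= mulr1 => <-.
by rewrite mulrN ![h * _]mulrC mulNr opprK.
Unshelve. all: by end_near. Qed.

End CenteredIncrement.

(** Solving the two identities for g (x + lambda h) shows that g is affine to
    the right of x, with slope k := (1 - lambda) / lambda times g'(x).  Reading
    the increment of g over two consecutive intervals from either left endpoint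
    shows that g' is constant, and the slope k c must then equal c. *)
Lemma derivative_affine (R : realType) (lambda : R) (g g' : R -> R) :
  0 < lambda -> lambda < 1 ->
  (forall x h : R, 0 < h ->
     g (x + lambda * h) - g (x - (1 - lambda) * h) = h * g' x) ->
  (forall x h : R, 0 < h ->
     lambda * g (x + lambda * h) + (1 - lambda) * g (x - (1 - lambda) * h)
       = g x) ->
  exists2 c : R, c * (1 - lambda) = c * lambda &
    forall x : R, g x = g 0 + c * x.
Proof.
move=> l0 l1 g_incr g_avg.
have ln0 : lambda != 0 by rewrite gt_eqF.
pose k := (1 - lambda) / lambda.
have k0 : k != 0 by rewrite gt_eqF// divr_gt0// subr_gt0.
have right_affine x t : 0 < t -> g (x + t) = g x + k * g' x * t.
  move=> t0.
  have h0 : 0 < t / lambda by rewrite divr_gt0.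
  have := g_incr x _ h0; have := g_avg x _ h0.
  have -> : lambda * (t / lambda) = t by field.
  set A := g (x + t); set B := g (x - _) => avg incr.
  have -> : k * g' x * t = (1 - lambda) * (t / lambda * g' x).
    by rewrite /k; field.
  by rewrite -incr -avg; ring.
have g'_right x t : 0 < t -> g' (x + t) = g' x.
  move=> t0.
  have t1 : 0 < t + 1 by rewrite addr_gt0.
  have := right_affine (x + t) 1 ltr01.
  rewrite -addrA (right_affine _ _ t1) (right_affine _ _ t0) => E.
  by apply: (mulfI k0); lra.
have g'_cst x : g' x = g' 0.
  have [x0|x0|->//] := ltgtP x 0.
  - by rewrite -[in RHS](subrK x 0) sub0r addrC g'_right// oppr_gt0.
  - by rewrite -[x in LHS]add0r g'_right.
have g_affine x : g x = g 0 + k * g' 0 * x.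
  have [x0|x0|->] := ltgtP x 0; last by rewrite mulr0 addr0.
  - have := right_affine x (- x); rewrite subrr oppr_gt0 => /(_ x0) ->.
    by rewrite g'_cst; ring.
  - by rewrite -[x in LHS]add0r right_affine.
have kc : k * g' 0 = g' 0.
  have := g_incr 0 1 ltr01; rewrite g_affine [g (_ - _)]g_affine => E.
  by lra.
exists (g' 0) => [|x]; last by rewrite g_affine kc.
by rewrite -{2}kc /k; field.
Qed.

Theorem theorem1 (R : realType) (lambda : R) (f : R -> R)
    (lambda_gt0 : 0 < lambda) (lambda_lt1 : lambda < 1)
    (f_differentiable : forall x : R, derivable f x 1)
    (f_mean_value : forall a b : R, a < b ->
       (f b - f a) / (b - a) = f^`()%classic (lambda * a + (1 - lambda) * b)) :
  is_polynomial_of_degree_at_most 2 f /\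
  (lambda <> 1 / 2 -> is_polynomial_of_degree_at_most 1 f).
Proof.
have f_incr := centered_increment _ _ _ _ f_mean_value.
have [g' g_incr] := derivative_increment _ _ _ f_differentiable f_incr.
have g_avg := derivative_average _ _ _ f_differentiable f_incr.
have [c c_lambda g_affine] :=
  derivative_affine _ _ _ _ lambda_gt0 lambda_lt1 g_incr g_avg.
set d := f^`()%classic 0 in g_affine.
have f_quadratic x : f x = f 0 + d * x + c / 2 * x ^+ 2.
  have half : c * lambda = c / 2 by lra.
  have half' : c * (1 - lambda) = c / 2 by lra.
  have [x0|x0|->] := ltgtP x 0; last by rewrite expr0n !mulr0 !addr0.
  - (* the interval [x, 0], of length - x *)
    have nx0 : 0 < - x by rewrite oppr_gt0.
    have := f_incr (lambda * x) (- x) nx0.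
    have -> : lambda * x + lambda * - x = 0 by ring.
    have -> : lambda * x - (1 - lambda) * - x = x by ring.
    by rewrite g_affine mulrA half => E; rewrite expr2; lra.
  - (* the interval [0, x] *)
    have := f_incr ((1 - lambda) * x) x x0.
    rewrite subrr.
    have -> : (1 - lambda) * x + lambda * x = x by ring.
    by rewrite g_affine mulrA half' => E; rewrite expr2; lra.
split=> [|lambda_neq].
  exists (Poly [:: f 0; d; c / 2]) => [|x]; first exact: size_Poly.
  by rewrite horner_Poly /= f_quadratic; ring.
have c0 : c = 0.
  have /eqP : c * (1 - 2 * lambda) = 0 by lra.
  by rewrite mulf_eq0 => /orP[/eqP//|/eqP E]; case: lambda_neq; lra.
exists (Poly [:: f 0; d]) => [|x]; first exact: size_Poly.
by rewrite horner_Poly /= f_quadratic c0; ring.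
Qed.
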